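(* Let $b$ be a positive integer. A $b$-colored partition of $n$ is a finite multiset of colored parts $r_c$, with $r\ge1$ and $c\in\{1,\dots,b\}$, whose sizes $r$ (counted with multiplicity) sum to $n$. For a $b$-colored partition $\pi$ and a positive integer $k$, let $g_k(\pi)$ be the number of colored parts $r_c$ (distinct pairs $(r,c)$) that occur at least $k$ times in $\pi$. Let $F_k(n)$ be the total number of parts of size $k$ (of any color, counted with multiplicity) in all $b$-colored partitions of $n$, and let $G_k(n)=\sum_{\pi}g_k(\pi)$, the sum over all $b$-colored partitions $\pi$ of $n$. Then for all $n=1,2,\dots$ and all $k=1,2,\dots,n$, $$F_k(n)=G_k(n).$$ *)

(* Defs.v *)
From mathcomp Require Import all_boot.
From mathcomp Require Import finmap multiset.

Set Implicit Arguments.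
Unset Strict Implicit.
Unset Printing Implicit Defensive.

Local Open Scope fset_scope.
Local Open Scope mset_scope.
Local Open Scope nat_scope.

(* The part r_c is the pair (r, c); the colors 1, ..., b are represented by
   the elements 0, ..., b - 1 of 'I_b. *)
Definition cpart (b : nat) := (nat * 'I_b)%type.

(* The coercion of a multiset to a sequence lists each element as many times
   as it occurs, so the sum is taken with multiplicity. *)
Definition is_colored_partition (b n : nat) (pi : {mset cpart b}) : bool :=
  all (fun x : cpart b => 0 < x.1) pi && (\sum_(x <- pi) x.1 == n).

(* The b-colored partitions of n have at most n parts, all of size at most n,
   so they are found among the finitely many multisets enumerated here: see
   colored_partitionsP. *)
Definition colored_partitions (b n : nat) : {fset {mset cpart b}} :=
  [fset pi in [seq seq_mset [seq (val x.1, x.2) : cpart b | x <- val s]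
              | s : n.-bseq ('I_n.+1 * 'I_b)%type]
   | is_colored_partition n pi].

Lemma colored_partitionsP (b n : nat) (pi : {mset cpart b}) :
  (pi \in colored_partitions b n) = is_colored_partition n pi.
Proof.
rewrite !inE /=; apply: andb_idl => /andP[/allP pi_gt0 /eqP sum_pi].
have le_part x : x \in (pi : seq _) -> x.1 < n.+1.
  by move=> x_pi; rewrite ltnS -sum_pi (big_rem x) //= leq_addr.
have le_size : size pi <= n.
  rewrite -sum_pi -sum1_size big_seq [leqRHS]big_seq.
  by apply: leq_sum => x /pi_gt0.
pose f (x : cpart b) : 'I_n.+1 * 'I_b := (inord x.1, x.2).
have le_size_f : size (map f pi) <= n by rewrite size_map.
apply/imageP; exists (Bseq le_size_f) => //=.
rewrite -map_comp map_id_in ?seq_mset_id // => -[r c] /le_part /= lt_r.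
by rewrite inordK.
Qed.

Definition g (b k : nat) (pi : {mset cpart b}) : nat :=
  #|` [fset x in finsupp pi | k <= pi x] |.

Definition nparts (b k : nat) (pi : {mset cpart b}) : nat :=
  count (fun x : cpart b => x.1 == k) pi.

Definition F (b k n : nat) : nat :=
  \sum_(pi <- colored_partitions b n) nparts k pi.

Definition G (b k n : nat) : nat :=
  \sum_(pi <- colored_partitions b n) g k pi.

(* Main.v *)
Require Import Defs.
From mathcomp Require Import all_boot.
From mathcomp Require Import finmap multiset.

(** Both sides count triples: [F] counts pairs (partition, k_c) with a further
    index 1 <= j <= multiplicity of k_c, and [G] counts pairs (partition, r_c)
    with r_c of multiplicity at least k.  Hence it suffices that, for j, r > 0,
    as many partitions contain r_c at least j times as contain j_c at least r
    times; replacing j copies of r_c by r copies of j_c is a bijection between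
    the two sets, since both blocks have sum j * r. *)

Set Implicit Arguments.
Unset Strict Implicit.
Unset Printing Implicit Defensive.

Local Open Scope mset_scope.
Local Open Scope nat_scope.

Lemma perm_msetD (K : choiceType) (A B : {mset K}) :
  perm_eq (A `+` B) ((A : seq K) ++ B).
Proof. by apply/allP => x _ /=; rewrite count_cat !count_mem_mset msetE2. Qed.

Lemma big_msetD (K : choiceType) (A B : {mset K}) (f : K -> nat) :
  \sum_(x <- A `+` B) f x = \sum_(x <- A) f x + \sum_(x <- B) f x.
Proof. by rewrite (perm_big _ (perm_msetD A B)) big_cat. Qed.

(** Turns a multiplicity into a sum of indicators whose range does not depend on the partition, so
    that sums can be exchanged. *)
Lemma sum_nat_leq n m : m <= n -> \sum_(1 <= j < n.+1) (j <= m : nat) = m.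
Proof.
move=> le_mn; rewrite (@big_cat_nat _ _ _ m.+1) //= -[RHS]addn0; congr (_ + _).
  under eq_big_nat => j /andP[_]; first by rewrite ltnS => ->; over.
  by rewrite sum_nat_const_nat subn1 muln1.
by rewrite big_nat big1 // => j /andP[]; rewrite ltnNge => /negbTE ->.
Qed.

Section Partitions.

Variable b : nat.
Implicit Types (n r j k : nat) (c : 'I_b) (pi : {mset cpart b}).

Definition swap_block j r c pi : {mset cpart b} :=
  (pi `\` msetn j ((r, c) : cpart b)) `+` msetn r ((j, c) : cpart b).

Lemma msetn_sub m (x : cpart b) pi : m <= pi x -> msetn m x `<=` pi.
Proof. by move=> le_m; apply/msubsetP => y; rewrite msetnE; case: eqP => // ->. Qed.

(** Removing the r copies of j_c just added is always exact; the hypothesis ensures that the first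
    removal took away j full copies of r_c, which are then put back. *)
Lemma swap_blockK j r c pi :
  j <= pi (r, c) -> swap_block r j c (swap_block j r c pi) = pi.
Proof. by move=> /msetn_sub le_j; rewrite /swap_block msetDKBC msetBDK. Qed.

Lemma swap_block_partition n j r c pi : 0 < j -> j <= pi (r, c) ->
  is_colored_partition n pi -> is_colored_partition n (swap_block j r c pi).
Proof.
move=> j_gt0 /msetn_sub le_j /andP[/allP pi_gt0 /eqP sum_pi]; apply/andP; split.
  (* The new parts have size j, positive by assumption; the others come from [pi]. *)
  apply/allP => x; rewrite in_msetD => /orP[]; last by case/msetnP => _ ->.
  by move/(msubset_subset (msubsetDl _ _)); apply: pi_gt0.
rewrite -sum_pi -[in eqbRHS](msetBDK le_j) !big_msetD !enum_msetn.
by rewrite !big_nseq !iter_addn_0 mulnC.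
Qed.

(** An injection suffices: the reverse inequality is the same statement with j and r exchanged. *)
Lemma swap_block_le n j r c : 0 < j ->
  count (fun pi => j <= pi (r, c)) (colored_partitions b n) <=
  count (fun pi => r <= pi (j, c)) (colored_partitions b n).
Proof.
move=> j_gt0; rewrite -!size_filter -(size_map (swap_block j r c)).
apply: uniq_leq_size.
  rewrite map_inj_in_uniq ?filter_uniq ?fset_uniq // => pi1 pi2.
  rewrite !mem_filter => /andP[le1 _] /andP[le2 _] eq_swap.
  by rewrite -(swap_blockK le1) eq_swap swap_blockK.
move=> _ /mapP[pi + ->]; rewrite !mem_filter => /andP[le_j].
rewrite !colored_partitionsP => /(swap_block_partition j_gt0 le_j) ->.
by rewrite andbT msetE2 msetnxx leq_addl.
Qed.

Lemma count_swap_block n j r c : 0 < j -> 0 < r ->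
  count (fun pi => j <= pi (r, c)) (colored_partitions b n) =
  count (fun pi => r <= pi (j, c)) (colored_partitions b n).
Proof. by move=> *; apply/eqP; rewrite eqn_leq !swap_block_le. Qed.

Lemma mset_leq_partition n pi (x : cpart b) :
  is_colored_partition n pi -> pi x <= n.
Proof.
move=> /andP[/allP pi_gt0 /eqP <-]; rewrite -count_mem_mset.
apply: leq_trans (count_size _ _) _; rewrite -sum1_size big_seq [leqRHS]big_seq.
by apply: leq_sum => y /pi_gt0.
Qed.

Lemma part_leq_partition n pi (x : cpart b) :
  is_colored_partition n pi -> x \in pi -> 0 < x.1 <= n.
Proof.
move=> /andP[/allP pi_gt0 /eqP <-] x_pi; rewrite pi_gt0 //=.
by rewrite (big_rem x) //= leq_addr.
Qed.

Lemma npartsE k pi : nparts k pi = \sum_c pi (k, c).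
Proof.
under eq_bigr => c _ do rewrite -count_mem_mset -sum1_count big_mkcond.
rewrite exchange_big /nparts -sum1_count big_mkcond; apply: eq_bigr => -[r d] _.
(* For an entry r_d of [pi], only the color c = d can contribute. *)
rewrite (bigD1 d) //= big1 => [|c ne_c]; last first.
  by rewrite xpair_eqE [d == c]eq_sym (negbTE ne_c) andbF.
by rewrite xpair_eqE eqxx andbT addn0.
Qed.

(** Bounding r by n loses nothing, since no part of a partition of n exceeds n; k > 0 forces every
    counted pair into the support. *)
Lemma gE n k pi : 0 < k -> is_colored_partition n pi ->
  g k pi = \sum_c \sum_(1 <= r < n.+1) (k <= pi (r, c)).
Proof.
move=> k_gt0 pi_n; rewrite exchange_big.
(* Flattened over pairs, the double sum is the size of a duplicate-free filtered list, so comparing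
   members is enough. *)
rewrite -(big_allpairs_dep (h := fun r c => (r, c) : cpart b)
            (F := fun x => k <= pi x : nat)).
rewrite -big_mkcond /= sum1_count -size_filter; apply/perm_size/uniq_perm.
- exact: fset_uniq.
- rewrite filter_uniq // allpairs_uniq ?iota_uniq ?index_enum_uniq //.
  by move=> [? ?] [? ?].
move=> [r c]; rewrite mem_filter !inE /= andbC; case: leqP => //= le_k.
have rc_pi : (r, c) \in pi by rewrite -mset_gt0 (leq_trans k_gt0).
rewrite msuppE rc_pi; apply/esym/allpairsP; exists (r, c); split => //=.
  by rewrite mem_index_iota ltnS (part_leq_partition pi_n rc_pi).
exact: mem_index_enum.
Qed.

End Partitions.

Theorem theorem2 (b : nat) (hb : 0 < b) (n k : nat) (hn : 1 <= n)
  (hk : 1 <= k <= n) : F b k n = G b k n.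
Proof.
have k_gt0 : 0 < k by case/andP: hk.
have -> : F b k n = \sum_(pi <- colored_partitions b n)
    \sum_c \sum_(1 <= j < n.+1) (j <= pi (k, c)).
  apply: eq_big_seq => pi; rewrite colored_partitionsP npartsE => pi_n.
  by apply: eq_bigr => c _; rewrite sum_nat_leq // mset_leq_partition.
have -> : G b k n = \sum_(pi <- colored_partitions b n)
    \sum_c \sum_(1 <= r < n.+1) (k <= pi (r, c)).
  by apply: eq_big_seq => pi; rewrite colored_partitionsP => /gE ->.
rewrite exchange_big [RHS]exchange_big; apply: eq_bigr => c _ /=.
(* The copy index on the left and the part size on the right both run over 1, ..., n, so they are
   matched term by term. *)
rewrite exchange_big [RHS]exchange_big; apply: eq_big_nat => j /andP[j_gt0 _].
have sum_count (P : pred {mset cpart b}) (s : seq {mset cpart b}) :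
    \sum_(pi <- s) P pi = count P s.
  by rewrite -sum1_count [RHS]big_mkcond; apply: eq_bigr => pi _; case: (P pi).
by rewrite !sum_count count_swap_block.
Qed.
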